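(* Given an $[n,k,d]$ MDS linear code $C$ over $F_q$, the array formed by taking the codewords of $C$ as columns is an $FPA_{q^{k-1}}(q^k, q^{k-1}(q-1))$.
   Context: $F_q$ denotes the finite field with $q$ elements. An $[n,k,d]$ linear code over $F_q$ is a $k$-dimensional subspace of $F_q^n$ with minimum Hamming distance $d$; it is maximal distance separable (MDS) if it satisfies the Singleton bound with equality, i.e. if $d = n-k+1$. Let $N=m\lambda$ with $N,m,\lambda$ positive integers. A $\lambda$-permutation of length $N$ is an arrangement (sequence of length $N$) of the multiset consisting of $m$ distinct symbols, each repeated exactly $\lambda$ times. The distance between two $\lambda$-permutations is the Hamming distance, i.e. the number of positions in which they disagree. A frequency permutation array of length $N$, frequency $\lambda$ and minimum distance $\delta$, denoted $FPA_\lambda(N,\delta)$, is a set of $\lambda$-permutations of length $N$ (on the same $m$ symbols) such that the distance between any two members is at least $\delta$; equivalently, it is an $s\times N$ array whose $s$ rows consist of $m$ distinct symbols, each repeated exactly $\lambda$ times, such that the distance between any two rows is at least $\delta$.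
   Formalization: For k = 1 rows of the array can coincide (e.g. the repetition code {00,11}), so ''any two rows at distance at least δ'' fails; the statement proved says the set of distinct rows is the FPA for every k, and that the array itself, row by row, is one when k ≥ 2. *)

(* Defs.v *)
From mathcomp Require Import all_boot all_order all_algebra.
Set Implicit Arguments.
Unset Strict Implicit.
Unset Printing Implicit Defensive.

(* Words of length N over an alphabet S are row vectors 'rV[S]_N. *)

Definition hamming_dist (S : finType) (N : nat) (u v : 'rV[S]_N) : nat :=
  #|[set j | u ord0 j != v ord0 j]|.

Definition is_min_dist (F : finFieldType) (n : nat) (C : {vspace 'rV[F]_n})
    (d : nat) : Prop :=
  (exists u v, [/\ u \in C, v \in C, u != v & hamming_dist u v = d]) /\
  (forall u v, u \in C -> v \in C -> u != v -> d <= hamming_dist u v).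

(* The minimum distance is attained by two distinct codewords, so a linear
   code in this sense has k >= 1 (and hence n >= 1). *)
Definition is_linear_code (F : finFieldType) (n k d : nat)
    (C : {vspace 'rV[F]_n}) : Prop :=
  \dim C = k /\ is_min_dist C d.

(* The truncated subtraction is harmless, since \dim C <= n. *)
Definition is_MDS_code (F : finFieldType) (n k d : nat)
    (C : {vspace 'rV[F]_n}) : Prop :=
  is_linear_code k d C /\ d = n - k + 1.

(* The m distinct symbols are the elements of S, so that m = #|S|. *)
Definition is_lambda_perm (S : finType) (lambda N : nat) (w : 'rV[S]_N) : Prop :=
  forall s : S, #|[set j | w ord0 j == s]| = lambda.

Definition is_FPA (S : finType) (lambda N delta : nat) (P : {set 'rV[S]_N}) :
    Prop :=
  [/\ 0 < N, N = #|S| * lambda,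
      forall w, w \in P -> is_lambda_perm lambda w
    & forall u v, u \in P -> v \in P -> u != v -> delta <= hamming_dist u v].

(* Rows are compared by index: two equal rows in distinct positions are at
   distance 0. *)
Definition is_FPA_array (S : finType) (lambda N delta s : nat)
    (A : 'M[S]_(s, N)) : Prop :=
  [/\ 0 < N, N = #|S| * lambda,
      forall i, is_lambda_perm lambda (row i A)
    & forall i i', i != i' -> delta <= hamming_dist (row i A) (row i' A)].

Definition row_set (S : finType) (s N : nat) (A : 'M[S]_(s, N)) :
    {set 'rV[S]_N} :=
  [set row i A | i in 'I_s].

(* Each codeword, transposed, is exactly one column of A; the order of the
   columns is arbitrary. *)
Definition columns_are_codewords (F : finFieldType) (n N : nat)
    (C : {vspace 'rV[F]_n}) (A : 'M[F]_(n, N)) : Prop :=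
  injective (fun j => col j A) /\
  (forall c : 'rV[F]_n, c \in C <-> exists j, col j A = (c^T)%R).

(* Main.v *)
Require Import Defs.
From mathcomp Require Import all_boot all_order all_algebra.

(** A linear functional that does not vanish on C takes each value equally
    often on C, hence #|C| / q times. The i-th row of A lists the values of the
    i-th coordinate functional on C, and two rows agree exactly where the
    difference of two such functionals vanishes. So it suffices that these
    functionals are nonzero on C. For a coordinate i and a set K of k - 1 other
    coordinates, two of the q^k codewords agree on K; as they are at distance at
    least n - k + 1, they differ at every coordinate outside K, so at i. *)

Import GRing.Theory.
Local Open Scope ring_scope.

(** Translation by a multiple of [c0] embeds any fiber of [f] on [C] into any other, so the [#|F|]
    fibers have equal size. *)
Lemma card_fiber_functional {F : finFieldType} {n : nat} {C : {vspace 'rV[F]_n}}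
    {f : 'rV[F]_n -> F} {c0 : 'rV[F]_n} (s : F) :
  scalar f -> c0 \in C -> f c0 != 0 ->
  (#|F| * #|[set c in C | f c == s]|)%N = #|C|.
Proof.
move=> lin_f c0C fc0.
pose fiber t := [set c in C | f c == t].
have fibers_le t t' : (#|fiber t| <= #|fiber t'|)%N.
  (* The coefficient is chosen so that the translation raises the value of [f] from [t] to [t']. *)
  pose shift (c : 'rV[F]_n) := ((t' - t) / f c0) *: c0 + c.
  rewrite -(card_imset (f := shift)); last by move=> u v /addrI.
  apply/subset_leq_card/subsetP => _ /imsetP[c + ->].
  rewrite !inE => /andP[cC /eqP fc].
  by rewrite memvD ?memvZ //= lin_f fc divfK // subrK.
rewrite -[RHS]sum1_card (partition_big f predT) //= -sum_nat_const.
apply: eq_bigr => t _; rewrite sum1_card.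
rewrite (_ : #|[set c in C | f c == s]| = #|fiber t|).
  by apply: eq_card => c; rewrite !inE.
by apply/eqP; rewrite eqn_leq !fibers_le.
Qed.

Lemma card_coordinate_words {F : finFieldType} {n : nat} (K : {set 'I_n}) :
  #|[set u : 'rV[F]_n | [forall i, (i \notin K) ==> (u ord0 i == 0)]]|
    = (#|F| ^ #|K|)%N.
Proof.
rewrite -(card_pffun_on (0 : F) (mem K) predT).
rewrite -(card_imset (f := fun u : 'rV[F]_n => [ffun i => u ord0 i])); last first.
  by move=> u v /ffunP uv; apply/rowP => i; have := uv i; rewrite !ffunE.
apply: eq_card => g; apply/imsetP/pffun_onP => [[u + ->]|[/subsetP gK _]].
  rewrite inE => /forallP uK; split=> //; apply/subsetP => i.
  by rewrite inE ffunE; apply: contraNT => iK; have := uK i; rewrite iK.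
exists (\row_i g i); last by apply/ffunP => i; rewrite ffunE mxE.
rewrite inE; apply/forallP => i; apply/implyP => iK; rewrite mxE.
by apply: contraNT iK => gi; apply: gK; rewrite inE.
Qed.

(** Pigeonhole: erasing the coordinates outside [K] sends [C] into a set of [#|F| ^ #|K|] words, so
    it cannot be injective on [C]. *)
Lemma codewords_agreeing_on (F : finFieldType) (n : nat) (C : {set 'rV[F]_n})
    (K : {set 'I_n}) :
  (#|F| ^ #|K| < #|C|)%N ->
  exists u v, [/\ u \in C, v \in C, u != v &
                  forall i, i \in K -> u ord0 i = v ord0 i].
Proof.
move=> ltKC; pose restr (u : 'rV[F]_n) := \row_i (if i \in K then u ord0 i else 0).
have /dinjectivePn[u uC [v /andP[vu vC] uv]] : ~~ dinjectiveb restr C.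
  apply: contraL ltKC => /dinjectiveP/card_in_imset <-; rewrite -leqNgt.
  rewrite -card_coordinate_words; apply/subset_leq_card/subsetP => _ /imsetP[u _ ->].
  by rewrite inE; apply/forallP => i; apply/implyP => /negPf iK; rewrite mxE iK.
exists u, v; split=> //; first by rewrite eq_sym.
by move=> i iK; have /rowP/(_ i) := uv; rewrite !mxE iK.
Qed.

Lemma MDS_codeword_vanishing_on {F : finFieldType} {n k d : nat}
    {C : {vspace 'rV[F]_n}} (K : {set 'I_n}) {i : 'I_n} :
  is_MDS_code k d C -> (#|F| ^ k)%N = #|C| -> #|K|.+1 = k -> i \notin K ->
  exists c, [/\ c \in C, c ord0 i != 0 & forall j, j \in K -> c ord0 j = 0].
Proof.
move=> [[_ [_ dist_ge]] dE] cardC cardK iK.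
have [|u [v []]] := @codewords_agreeing_on F n [set c in C] K.
  by rewrite cardsE -cardC -cardK ltn_exp2l ?card_finNzRing_gt1.
rewrite !inE => uC vC uv uvK; exists (u - v); split=> [|| j jK].
- exact: memvB.
(* If [u] and [v] also agreed at [i], they would agree on the [k] coordinates of [i |: K], so their
   distance would be at most [n - k], which is less than [d]. *)
- rewrite !mxE subr_eq0; apply: contraTneq (dist_ge u v uC vC uv) => uvi.
  rewrite -ltnNge dE /hamming_dist addn1 ltnS.
  have /subset_leq_card/leq_trans-> // :
      [set j | u ord0 j != v ord0 j] \subset ~: (i |: K).
    apply/subsetP => j; rewrite !inE negb_or => uvj.
    apply/andP; split; apply: contraNN uvj; last by move/uvK->.
    by move/eqP->; apply/eqP.
  by rewrite cardsCs setCK card_ord cardsU1 iK add1n cardK.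
- by rewrite !mxE uvK // subrr.
Qed.

Lemma exists_subset_card (T : finType) (A B : {set T}) (m : nat) :
  A \subset B -> (#|A| <= m <= #|B|)%N ->
  exists K : {set T}, [/\ A \subset K, K \subset B & #|K| = m].
Proof.
move=> AB /andP[]; elim: m => [|m IH]; rewrite leq_eqVlt.
  by rewrite orbF => /eqP A0 _; exists A.
case/orP => [/eqP Am _|lt_Am lt_mB]; first by exists A.
have [K [AK KB Km]] := IH lt_Am (ltnW lt_mB).
have /properP[_ [x xB xK]] : K \proper B by rewrite properEcard KB Km.
exists (x |: K); split; last by rewrite cardsU1 xK Km.
- exact: subset_trans AK (subsetUr _ _).
- by rewrite subUset sub1set xB KB.
Qed.

Local Close Scope ring_scope.

Theorem theorem3p10 (F : finFieldType) (q n k d : nat) (C : {vspace 'rV[F]_n})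
    (A : 'M[F]_(n, q ^ k))
    (hq : #|F| = q)
    (hC : is_MDS_code k d C)
    (hA : columns_are_codewords C A) :
  is_FPA (q ^ (k - 1)) (q ^ (k - 1) * (q - 1)) (row_set A) /\
  (1 < k -> is_FPA_array (q ^ (k - 1)) (q ^ (k - 1) * (q - 1)) A).
Proof.
have q_gt1 : 1 < q by rewrite -hq card_finNzRing_gt1.
have [[dimC [[u [v [uC vC uv _]]] _]] _] := hC.
have k_gt0 : 0 < k.
  rewrite -dimC lt0n dimv_eq0; apply: contraNneq uv => C0.
  by move: uC vC; rewrite C0 !memv0 => /eqP-> /eqP->.
have le_kn : k <= n by have := dimvS (subvf C); rewrite dimC dimvf /dim /= mul1n.
have [col_inj colC] := hA.
pose word j := ((col j A)^T)%R.
have word_inj : injective word by move=> j j' /trmx_inj/col_inj.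
have wordE j i : word j ord0 i = A i j by rewrite !mxE.
have wordC c : reflect (exists j, c = word j) (c \in C).
  apply: (iffP idP) => [/colC[j jc]|[j ->]]; first by exists j; rewrite /word jc trmxK.
  by apply/colC; exists j; rewrite trmxK.
(* Columns of [A] and codewords are in bijection, so positions in a row can be counted as
   codewords. *)
have card_words (P : pred 'rV[F]_n) :
    #|[set j | P (word j)]| = #|[set c in C | P c]|.
  rewrite -(card_imset _ word_inj); apply: eq_card => c; rewrite !inE.
  apply/imsetP/andP => [[j + ->]|[/wordC[j ->] Pj]]; last by exists j; rewrite ?inE.
  by rewrite inE => Pj; split=> //; apply/wordC; exists j.
have cardC : q ^ k = #|C|.
  rewrite -[LHS]card_ord -cardsT (card_words predT).
  by apply: eq_card => c; rewrite inE andbT.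
have qkE : q ^ k = q * q ^ (k - 1) by rewrite -expnS subn1 prednK.
have fiberE f c0 s : scalar f -> c0 \in C -> f c0 != 0%R ->
    #|[set j | f (word j) == s]| = q ^ (k - 1).
  move=> lin_f c0C fc0; rewrite (card_words (fun c => f c == s)).
  apply/eqP; rewrite -(eqn_pmul2l (ltnW q_gt1)) -qkE cardC -hq; apply/eqP.
  exact: card_fiber_functional fc0.
have lambda_perm i : is_lambda_perm (q ^ (k - 1)) (row i A).
  have [||K [_ /subsetP Ki cardK]] :=
      @exists_subset_card _ set0 (~: [set i]) (k - 1).
  - exact: sub0set.
  - by rewrite cards0 cardsC1 card_ord subn1 /=; case: (k) (n) k_gt0 le_kn => [|?] [].
  have iK : i \notin K by apply/negP => /Ki; rewrite !inE eqxx.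
  have [|| c [cC ci _]] := MDS_codeword_vanishing_on K hC _ _ iK.
  - by rewrite hq.
  - by rewrite cardK subn1 prednK.
  move=> s; rewrite -(fiberE (fun c : 'rV_n => c ord0 i) c s) //.
    by apply: eq_card => j; rewrite !inE wordE mxE.
  by move=> a x y; rewrite !mxE.
(* The rows agree on the zero fiber of the functional [c_i - c_i'], which has [q ^ (k - 1)] of the
   [q ^ k] positions; [c0] witnesses that this functional is nonzero on [C]. *)
have dist_rows i i' c0 : c0 \in C -> c0 ord0 i != c0 ord0 i' ->
    hamming_dist (row i A) (row i' A) = q ^ (k - 1) * (q - 1).
  move=> c0C c0i; rewrite /hamming_dist cardsCs card_ord.
  rewrite mulnBr muln1 [_ * q]mulnC -qkE; congr (_ - _).
  rewrite -(fiberE (fun c : 'rV_n => c ord0 i - c ord0 i')%R c0 0%R) ?subr_eq0 //.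
    by apply: eq_card => j; rewrite !inE subr_eq0 !wordE !mxE negbK.
  by move=> a x y; rewrite !mxE opprD addrACA /= mulrBr.
have N_gt0 : 0 < q ^ k by rewrite expn_gt0 ltnW.
have NE : q ^ k = #|F| * q ^ (k - 1) by rewrite hq.
split.
  split=> // [w /imsetP[i _ ->] //|_ _ /imsetP[i _ ->] /imsetP[i' _ ->] neq_row].
  (* Rows distinct as words differ in some column, and the codeword in that column is the required
     witness, even when [k = 1]. *)
  have [j neq_j] : exists j, A i j != A i' j.
    apply/existsP; apply: contraNT neq_row => /existsPn eqA; apply/eqP/rowP => j.
    by rewrite !mxE; apply/eqP; have := eqA j; rewrite negbK.
  rewrite (dist_rows i i' (word j)) ?wordE //.
  by apply/wordC; exists j.
(* Here distinct indices might still carry equal rows, as in a repetition code, where [k = 1]. With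
   [1 < k], the set [K] has room for [i'], which gives a codeword that is zero at [i'] but not at
   [i]. *)
move=> k_gt1; split=> // i i' neq_i.
have [||K [/subsetP i'K /subsetP Ki cardK]] :=
    @exists_subset_card _ [set i'] (~: [set i]) (k - 1).
- by rewrite sub1set !inE eq_sym.
- rewrite cards1 cardsC1 card_ord subn_gt0 k_gt1 subn1 /=.
  by case: (k) (n) k_gt0 le_kn => [|?] [].
have iK : i \notin K by apply/negP => /Ki; rewrite !inE eqxx.
have [|| c [cC ci cK]] := MDS_codeword_vanishing_on K hC _ _ iK.
- by rewrite hq.
- by rewrite cardK subn1 prednK.
by rewrite (dist_rows i i' c) // [X in _ != X]cK // i'K ?inE.
Qed.
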